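(* Let $\beta$ be a permutation that is itself a 2413-balloon (that is, $\beta = 2413 \circledcirc \gamma$ for some non-empty permutation $\gamma$), and let $\pi = 2413 \circledcirc \beta$. Then $\mu[1,\pi] = 2\,\mu[1,\beta]$.
   Context: Permutations are written in one-line notation, and $|\pi|$ denotes the length of $\pi$. A permutation $\sigma=\sigma_1\cdots\sigma_m$ is contained in $\pi=\pi_1\cdots\pi_n$, written $\sigma\le\pi$, if there are indices $1\le i_1<\dots<i_m\le n$ such that for all $r,s\in\{1,\dots,m\}$, $\pi_{i_r}<\pi_{i_s}$ if and only if $\sigma_r<\sigma_s$. The set of all (non-empty) permutations of all lengths is a poset under $\le$. The Möbius function on this poset is defined by: $\mu[\sigma,\pi]=0$ if $\sigma\nleq\pi$; $\mu[\pi,\pi]=1$; and for $\sigma<\pi$, $\mu[\sigma,\pi]=-\sum_{\sigma\le\lambda<\pi}\mu[\sigma,\lambda]$. In $\mu[1,\pi]$, the symbol $1$ is the permutation of length 1. For a non-empty permutation $\beta$, the 2413-balloon of $\beta$, written $2413\circledcirc\beta$, is the permutation of length $|\beta|+4$ given by $(2413\circledcirc\beta)_1=2$; $(2413\circledcirc\beta)_2=|\beta|+4$; $(2413\circledcirc\beta)_i=\beta_{i-2}+2$ for $2<i\le|\beta|+2$; $(2413\circledcirc\beta)_{|\beta|+3}=1$; $(2413\circledcirc\beta)_{|\beta|+4}=|\beta|+3$. A permutation is called a 2413-balloon if it equals $2413\circledcirc\beta$ for some non-empty permutation $\beta$. *)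

(* Defs.v *)
From HB Require Import structures.
From mathcomp Require Import all_boot all_order all_algebra.
From mathcomp Require Import zify.

Set Implicit Arguments.
Unset Strict Implicit.
Unset Printing Implicit Defensive.

Import Order.TTheory.

Definition is_pperm (s : seq nat) : bool :=
  (s != [::]) && perm_eq s (iota 1 (size s)).

(* Non-empty permutations in one-line notation, with values 1, ..., n; the
   entry pi_i is [nth 0 p i.-1]. *)
Record pperm := PPerm { oneline :> seq nat; _ : is_pperm oneline }.

HB.instance Definition _ := [isSub for oneline].
HB.instance Definition _ := [Choice of pperm by <:].

Definition contained (s p : seq nat) : bool :=
  [exists f : {ffun 'I_(size s) -> 'I_(size p)},
    [forall r : 'I_(size s), forall t : 'I_(size s), (r < t) ==> (f r < f t)] &&
    [forall r : 'I_(size s), forall t : 'I_(size s),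
      (nth 0 p (f r) < nth 0 p (f t)) == (nth 0 s r < nth 0 s t)]].

Lemma containedP (s p : seq nat) :
  reflect (exists f : 'I_(size s) -> 'I_(size p),
             (forall r t : 'I_(size s), r < t -> f r < f t) /\
             (forall r t : 'I_(size s), (nth 0 p (f r) < nth 0 p (f t))
                          = (nth 0 s r < nth 0 s t)))
          (contained s p).
Proof.
apply: (iffP existsP) => [[f /andP[/forallP fi /forallP fo]]|[f [fi fo]]].
  exists f; split=> r t; first by move/forallP: (fi r) => /(_ t)/implyP.
  by move/forallP: (fo r) => /(_ t)/eqP.
exists [ffun i => f i]; apply/andP; split; apply/forallP=> r;
  apply/forallP=> t; rewrite !ffunE; first by apply/implyP/fi.
by apply/eqP/fo.
Qed.

Lemma contained_size s p : contained s p -> size s <= size p.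
Proof.
case/containedP=> f [fi _].
have f_inj : injective f.
  have nlt (u v : 'I_(size s)) : f u = f v -> ~~ (u < v).
    by move=> e; apply/negP=> /fi; rewrite e ltnn.
  move=> r t e; apply: ord_inj; have := nlt r t e; have := nlt t r (esym e).
  lia.
by have := leq_card f f_inj; rewrite !card_ord.
Qed.

Lemma nth_pperm (p : pperm) i : i < size p ->
  nth 0 p i = (count (fun x => x < nth 0 p i) p).+1.
Proof.
case: p => s /= /andP[_ ps] lti.
have: nth 0 s i \in iota 1 (size s) by rewrite -(perm_mem ps) mem_nth.
rewrite (permP ps) mem_iota; move: (nth 0 s i) => v /andP[v1 v2].
have ->: size s = v.-1 + (size s - v.-1) by lia.
rewrite iotaD count_cat.
have ->: count (fun x => x < v) (iota 1 v.-1) = size (iota 1 v.-1).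
  by apply/eqP; rewrite -all_count; apply/allP=> x; rewrite mem_iota; lia.
have /eqP ->: count (fun x => x < v) (iota (1 + v.-1) (size s - v.-1)) == 0.
  by rewrite -leqn0 leqNgt -has_count; apply/hasPn=> x; rewrite mem_iota; lia.
rewrite size_iota; lia.
Qed.

Lemma contained_eq (s p : pperm) : contained s p -> size s = size p -> s = p.
Proof.
case/containedP=> f [fi fo] es.
have ge (r : 'I_(size s)) : r <= f r.
  case: r => n; elim: n => [|n IHn] Hn //=.
  have Hn' : n < size s by apply: ltnW.
  by apply: leq_ltn_trans (IHn Hn') (fi _ _ _).
have le (r : 'I_(size s)) : f r <= r.
  suff H k (r' : 'I_(size s)) : r' + k.+1 = size s -> f r' + k < size s.
    have := H (size s - r.+1) r; have := ltn_ord r; lia.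
  elim: k r' => [|k IHk] r'; first by move=> _; rewrite addn0 es.
  move=> e; have Hn : r'.+1 < size s by lia.
  have := IHk (Ordinal Hn); have := fi r' (Ordinal Hn) => /=; lia.
have fE (r : 'I_(size s)) : f r = r :> nat by apply/eqP; rewrite eqn_leq ge le.
apply: val_inj; apply: (@eq_from_nth _ 0) => // i lti /=.
have lti' : i < size p by rewrite -es.
rewrite (nth_pperm lti) (nth_pperm lti'); congr _.+1.
have cE (q : seq nat) v :
    count (fun x => x < v) q = count (fun j => nth 0 q j < v) (iota 0 (size q)).
  by rewrite -[q in LHS](mkseq_nth 0) /mkseq count_map.
rewrite !cE -es; apply: eq_in_count => j; rewrite mem_iota /= add0n => ltj.
by rewrite -(fo (Ordinal ltj) (Ordinal lti)) !fE.
Qed.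

Fact pattern_display : Order.disp_t. Proof. exact: Order.Disp tt tt. Qed.

Lemma contained_refl : reflexive (fun s p : pperm => contained s p).
Proof. by move=> p; apply/containedP; exists id. Qed.

Lemma contained_anti : antisymmetric (fun s p : pperm => contained s p).
Proof.
move=> s p /andP[sp ps]; apply: contained_eq (sp) _.
by apply/eqP; rewrite eqn_leq !contained_size.
Qed.

Lemma contained_trans : transitive (fun s p : pperm => contained s p).
Proof.
move=> q s p /containedP[f [fi fo]] /containedP[g [gi go]].
apply/containedP; exists (g \o f); split=> r t /=; first by move/fi/gi.
by rewrite go.
Qed.

HB.instance Definition _ := Order.Le_isPOrder.Build pattern_display pperm
  contained_refl contained_anti contained_trans.

Lemma le_pperm (s p : pperm) : (s <= p)%O = contained s p.
Proof. by []. Qed.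

Definition pperms_upto (n : nat) : seq pperm :=
  pmap insub (flatten [seq permutations (iota 1 k) | k <- iota 1 n]).

Lemma mem_pperms_upto n (p : pperm) : (p \in pperms_upto n) = (size p <= n).
Proof.
rewrite mem_pmap_sub; apply/flatten_mapP/idP => [[k]|le_pn].
  rewrite mem_iota mem_permutations => ? /perm_size.
  by rewrite size_iota /=; lia.
case: p le_pn => s /= /andP[s0 ps] le_sn; exists (size s).
  by rewrite mem_iota; case: s s0 le_sn {ps} => //=; lia.
by rewrite mem_permutations.
Qed.

Lemma uniq_pperms_upto n : uniq (pperms_upto n).
Proof.
apply: pmap_sub_uniq; elim: n => // n IHn.
rewrite -[n.+1]addn1 iotaD map_cat flatten_cat cat_uniq IHn /= cats0.
rewrite permutations_uniq andbT; apply/hasPn=> s.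
rewrite mem_permutations => /perm_size; rewrite /= size_iota => es.
apply/negP=> /flatten_mapP[k]; rewrite mem_iota mem_permutations => ltk.
move/perm_size; rewrite size_iota es => ek.
by move: ltk; rewrite -ek add0n add1n ltnn andbF.
Qed.

(* [s, p): the restriction on the length is harmless, see [mem_pinterval]. *)
Definition pinterval (s p : pperm) : seq pperm :=
  [seq l <- pperms_upto (size p) | (s <= l)%O && (l < p)%O].

Lemma lt_size (s p : pperm) : (s < p)%O -> size s < size p.
Proof.
rewrite lt_neqAle => /andP[nsp le_sp]; rewrite ltn_neqAle contained_size //.
by rewrite andbT; apply: contraNneq nsp => /(contained_eq le_sp) ->.
Qed.

Lemma mem_pinterval (s p l : pperm) :
  (l \in pinterval s p) = (s <= l)%O && (l < p)%O.
Proof.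
rewrite mem_filter mem_pperms_upto; case: (boolP (l < p)%O) => [lp|_].
  by rewrite (ltnW (lt_size lp)) andbT.
by rewrite andbF.
Qed.

Lemma uniq_pinterval (s p : pperm) : uniq (pinterval s p).
Proof. exact/filter_uniq/uniq_pperms_upto. Qed.

Local Open Scope ring_scope.

(* [n] is a recursion bound; any [n >= size p] gives the same value. *)
Fixpoint mobius_rec (n : nat) (s p : pperm) : int :=
  if n is n'.+1 then
    if s == p then 1
    else if (s < p)%O then - \sum_(l <- pinterval s p) mobius_rec n' s l
    else 0
  else 0.

Definition mobius (s p : pperm) : int := mobius_rec (size p) s p.

Lemma size_pperm_gt0 (p : pperm) : (0 < size p)%N.
Proof. by case: p => -[|x s]. Qed.

Lemma mobius_rec_bound n m (s p : pperm) :
  (size p <= n)%N -> (size p <= m)%N -> mobius_rec n s p = mobius_rec m s p.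
Proof.
elim: n m p => [|n IHn] [|m] p; try by move: (size_pperm_gt0 p); lia.
move=> le_pn le_pm /=; case: eqP => // _; case: ifP => // _; congr (- _).
apply: eq_big_seq => l; rewrite mem_pinterval => /andP[_ /lt_size lp].
by apply: IHn; lia.
Qed.

Lemma mobius_nle (s p : pperm) : ~~ (s <= p)%O -> mobius s p = 0.
Proof.
rewrite /mobius le_eqVlt negb_or => /andP[/negbTE n1 /negbTE n2].
by case: (size p) => //= n; rewrite n1 n2.
Qed.

Lemma mobius_refl (p : pperm) : mobius p p = 1.
Proof. by rewrite /mobius -(prednK (size_pperm_gt0 p)) /= eqxx. Qed.

Lemma mobius_lt (s p : pperm) : (s < p)%O ->
  mobius s p = - \sum_(l <- pinterval s p) mobius s l.
Proof.
move=> lt_sp; rewrite {1}/mobius -(prednK (size_pperm_gt0 p)) /=.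
rewrite (lt_eqF lt_sp) lt_sp; congr (- _).
apply: eq_big_seq => l; rewrite mem_pinterval => /andP[_ /lt_size lp].
by apply: mobius_rec_bound; lia.
Qed.

Local Close Scope ring_scope.

Definition one_pperm : pperm := @PPerm [:: 1] isT.

Definition balloon2413_seq (b : seq nat) : seq nat :=
  [:: 2; size b + 4] ++ [seq x + 2 | x <- b] ++ [:: 1; size b + 3].

Lemma balloon2413_subproof (b : pperm) : is_pperm (balloon2413_seq b).
Proof.
case: b => b /= /andP[_ pb]; rewrite /is_pperm /balloon2413_seq /=.
rewrite size_cat size_map /=.
rewrite (iotaD 3 _ 2) /= -addSn [3 + _]addnC [4 + _]addnC.
have eb : perm_eq [seq x + 2 | x <- b] (iota 3 (size b)).
  rewrite (iotaDl 2 1) (eq_map (fun x => addnC x 2)); exact: perm_map.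
apply/permP=> a; move/permP: eb => /(_ a).
rewrite /= !count_cat /=; lia.
Qed.

Definition balloon2413 (b : pperm) : pperm :=
  PPerm (balloon2413_subproof b).

Definition is_balloon2413 (p : pperm) : Prop :=
  exists b : pperm, p = balloon2413 b.

(* Main.v *)
Require Import Defs.
From mathcomp Require Import all_boot all_order all_algebra.
From mathcomp Require Import zify ring.

(* Write M for mobius one_pperm, b p for the 2413-balloon of p, and L, R, T, B
   for the operations p |-> 1 (+) p, p (+) 1, 1 (-) p, p (-) 1 that add a point
   in a corner.  The sum of M over a principal order ideal vanishes unless the
   ideal is that of 1; pairing s with X s then gives M (X p) = - M p if p has no
   X-corner and M (X p) = 0 otherwise, for X any of L, R, T, B.  A permutation
   below b a either avoids one of the four outer points, hence lies in the
   ideal A generated by TRBa, RBLa, BLTa and LTRa, or is 2413 or b d for some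
   d <= a; the latter have no corners, so they lie in A iff they lie below a.
   Cancelling along corners shows that the sum of M over A is minus its sum over
   the ideal of a.  Hence
     sum_(d <= a) M (b d) = [a = 1] + sum_(b d <= a) M (b d)
                            + [2413 <= a] M 2413 - M 2413   for all a,
   and Moebius inversion gives M (b a) = M a + [a is a balloon] M a up to
   corrections at a = 1 and a = 2413. *)

Set Implicit Arguments.
Unset Strict Implicit.
Unset Printing Implicit Defensive.

Import Order.TTheory GRing.Theory.

(** * Containment through standardization *)

(** Ranks count from 1, so a duplicate-free non-empty [s] becomes the permutation order-isomorphic
    to it. *)
Definition std (s : seq nat) : seq nat :=
  [seq (count (fun y => y < x) s).+1 | x <- s].

Lemma size_std s : size (std s) = size s.
Proof. exact: size_map. Qed.

Lemma std_map (g : nat -> nat) (s : seq nat) :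
  {in s &, {mono g : x y / x < y}} -> std (map g s) = std s.
Proof.
move=> gm; rewrite /std -map_comp; apply/eq_in_map => x xs /=.
by rewrite count_map; congr _.+1; apply: eq_in_count => y ys /=; apply: gm.
Qed.

Lemma std_lt (s : seq nat) x y : x \in s ->
  (count (fun z => z < x) s < count (fun z => z < y) s) = (x < y).
Proof.
move=> xs; case: (ltnP x y) => [xy|yx]; last first.
  by apply/negbTE; rewrite -leqNgt; apply: sub_count => z /= /leq_trans; apply.
have -> : count (fun z => z < y) s = count (fun z => z < x) s +
    count (fun z => x <= z < y) s.
  elim: s {xs} => //= z s ->; lia.
(* The surplus is at least one: [x] itself lies below [y] but not below [x]. *)
rewrite -[X in X < _]addn0 ltn_add2l -has_count; apply/hasP; exists x => //.
by rewrite leqnn.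
Qed.

(** The ranks are pairwise distinct and lie between 1 and the length, so they fill that range. *)
Lemma std_pperm s : uniq s -> s != [::] -> is_pperm (std s).
Proof.
move=> us s0; rewrite /is_pperm -size_eq0 size_std size_eq0 s0 /=.
have ustd : uniq (std s).
  rewrite map_inj_in_uniq // => x y xs ys [e].
  by have := std_lt y xs; have := std_lt x ys; rewrite e ltnn; lia.
have sub : {subset std s <= iota 1 (size s)}.
  move=> _ /mapP[x xs ->]; rewrite mem_iota ltnS /= add1n ltnS ltnNge.
  apply/negP=> le.
  have : all (fun y => y < x) s by rewrite all_count eqn_leq count_size le.
  by move/allP/(_ _ xs); rewrite ltnn.
apply: uniq_perm => //; first exact: iota_uniq.
by case: (uniq_min_size ustd sub) => //; rewrite size_std size_iota.
Qed.

Lemma pperm_uniq (p : pperm) : uniq p.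
Proof. by case: p => s /= /andP[_ /perm_uniq ->]; apply: iota_uniq. Qed.

Lemma pperm_mem (p : pperm) x : (x \in (p : seq nat)) = (0 < x <= size p).
Proof. by case: p => s /= /andP[_ /perm_mem ->]; rewrite mem_iota; lia. Qed.

Lemma std_id (p : pperm) : std p = p.
Proof.
apply: (@eq_from_nth _ 0); rewrite size_std // => i ip.
by rewrite (nth_map 0) // -nth_pperm.
Qed.

Lemma subseq_mapP (T1 T2 : eqType) (g : T1 -> T2) (s : seq T1) t :
  subseq t (map g s) -> exists2 t', subseq t' s & t = map g t'.
Proof.
case/subseqP=> m sm ->; exists (mask m s); last by rewrite map_mask.
exact: mask_subseq.
Qed.

(** Trades index embeddings for subsequences, where adding and deleting points is easy to describe.
    An embedding corresponds to the mask selecting its image, and agreement of orders to equality of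
    ranks. *)
Lemma le_stdP (l p : pperm) :
  reflect (exists2 t, subseq t p & l = std t :> seq nat) (l <= p)%O.
Proof.
rewrite le_pperm; apply: (iffP (containedP _ _)).
  case=> f [fi fo].
  pose t := [seq nth 0 p (f r) | r <- enum 'I_(size l)].
  have st : size t = size l by rewrite size_map size_enum_ord.
  exists t.
    rewrite -[X in subseq _ X](mkseq_nth 0) /mkseq.
    rewrite /t (map_comp (nth 0 p) (fun r => f r : nat)); apply: map_subseq.
    rewrite (_ : [seq _ | _ <- _] =
      [seq i <- iota 0 (size p) | i \in [seq (f r : nat) | r <- enum 'I_(size l)]]).
      exact: filter_subseq.
    (* Both index lists are strictly increasing with the same members, hence equal. *)
    apply: (irr_sorted_eq ltn_trans ltnn).
    - have so : sorted (relpre val ltn) (enum 'I_(size l)).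
        by rewrite -sorted_map val_enum_ord iota_ltn_sorted.
      by rewrite sorted_map; apply: sub_sorted so => r r' /= /fi.
    - by apply: sorted_filter; [exact: ltn_trans|exact: iota_ltn_sorted].
    move=> i; rewrite mem_filter mem_iota /= add0n.
    case: (boolP (i \in _)) => //= /mapP[r _ ->]; by rewrite ltn_ord.
  apply: (@eq_from_nth _ 0); first by rewrite size_std st.
  move=> i il; rewrite (nth_pperm il) (nth_map 0) ?st //; congr _.+1.
  rewrite /t count_map.
  have nE (j : 'I_(size l)) : nth 0 [seq nth 0 p (f r) | r <- enum 'I_(size l)] j
      = nth 0 p (f j).
    by rewrite (nth_map j) ?size_enum_ord // nth_ord_enum.
  rewrite -[i]/(val (Ordinal il)) nE.
  rewrite -[X in count _ X = _](mkseq_nth 0) /mkseq -val_enum_ord -map_comp count_map.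
  by apply: eq_count => r /=; rewrite (fo r (Ordinal il)).
case=> t /subseqP[m sm ->] ls.
have sz : size l = size (mask m (iota 0 (size p))).
  by rewrite ls size_std !size_mask ?size_iota.
have tE : mask m p = map (nth 0 p) (mask m (iota 0 (size p))).
  by rewrite map_mask -[in LHS](mkseq_nth 0 p).
have lt_ (r : 'I_(size l)) : nth 0 (mask m (iota 0 (size p))) r < size p.
  have : nth 0 (mask m (iota 0 (size p))) r \in iota 0 (size p).
    by apply: (mem_mask (m := m)); rewrite mem_nth -?sz.
  by rewrite mem_iota.
exists (fun r => Ordinal (lt_ r)); split=> r r' /=.
  have so : sorted ltn (mask m (iota 0 (size p))).
    by apply: sorted_mask; [exact: ltn_trans|exact: iota_ltn_sorted].
  by apply: (sorted_ltn_nth ltn_trans 0 so); rewrite inE -sz.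
have nE (j : 'I_(size l)) : nth 0 p (nth 0 (mask m (iota 0 (size p))) j)
    = nth 0 (mask m p) j.
  by rewrite tE (nth_map 0) // -sz.
have jl (j : 'I_(size l)) : j < size (mask m p).
  by rewrite tE size_map -sz.
have lE (j : 'I_(size l)) : nth 0 l j =
    (count (fun y => y < nth 0 (mask m p) j) (mask m p)).+1.
  by rewrite {1}ls (nth_map 0).
rewrite !nE !lE ltnS.
by rewrite std_lt // mem_nth.
Qed.

(** * Adding a corner point *)

Lemma pperm_neq0 (p : pperm) : (p : seq nat) != [::].
Proof. by case: p => s /= /andP[]. Qed.

Lemma pperm_perm (p : pperm) : perm_eq p (iota 1 (size p)).
Proof. by case: p => s /= /andP[]. Qed.

Lemma le_one (p : pperm) : (one_pperm <= p)%O.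
Proof.
apply/le_stdP; exists [:: head 0 p] => //.
by case: (p : seq nat) (pperm_neq0 p) => //= x s _; rewrite eqxx sub0seq.
by rewrite /std /= ltnn.
Qed.

Lemma pperm_size1 (p : pperm) : size p = 1 -> p = one_pperm.
Proof. by move=> p1; apply/esym/contained_eq; [exact: le_one|rewrite p1]. Qed.

Definition add_end (b : bool) (x : nat) s := if b then x :: s else rcons s x.

Lemma perm_add_end b x s : perm_eql (add_end b x s) (x :: s).
Proof. by case: b => //; apply/permPl; rewrite perm_rcons. Qed.

Lemma size_add_end b x s : size (add_end b x s) = (size s).+1.
Proof. by case: b; rewrite //= size_rcons. Qed.

Lemma map_add_end b g x s : map g (add_end b x s) = add_end b (g x) (map g s).
Proof. by case: b; rewrite //= map_rcons. Qed.

Lemma subseq_add_end b x s t : subseq t s -> subseq (add_end b x t) (add_end b x s).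
Proof. by case: b => ts; rewrite /= ?eqxx // -!cats1 cat_subseq. Qed.

Lemma subseq_add_end_cases b x s t : subseq t (add_end b x s) ->
  subseq t s \/ exists2 t', subseq t' s & t = add_end b x t'.
Proof.
have H u v : subseq u (x :: v) -> subseq u v \/ exists2 u', subseq u' v & u = x :: u'.
  case: u => [|y u] /=; first by left; apply: sub0seq.
  by case: eqP => [->|_]; [right; exists u|left].
case: b; first exact: H.
rewrite /= -subseq_rev rev_rcons => /H[|[u us tu]].
  by rewrite subseq_rev; left.
right; exists (rev u); first by rewrite -subseq_rev revK.
by rewrite -rev_cons -tu revK.
Qed.

Lemma std_add_end b x t :
  std (add_end b x t) = add_end b (count (fun y => y < x) t).+1
    [seq (count (fun z => z < y) t + (x < y)).+1 | y <- t].
Proof.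
rewrite /std; have E y : count (fun z => z < y) (add_end b x t) =
    count (fun z => z < y) t + (x < y).
  by rewrite (permP (permEl (perm_add_end b x t))) /= addnC.
rewrite (eq_map (fun y => congr1 succn (E y))) map_add_end ltnn addn0 //.
Qed.

(* The new point is the first one if [b] and the last one otherwise; it is the
   lowest one if [v] and the highest one otherwise. *)
Definition corner_seq (b v : bool) (p : seq nat) : seq nat :=
  add_end b (if v then 1 else (size p).+1) (if v then map succn p else p).

Lemma corner_subproof b v (p : pperm) : is_pperm (corner_seq b v p).
Proof.
apply/andP; split; first by rewrite -size_eq0 size_add_end.
rewrite /corner_seq size_add_end perm_add_end.
case: v; last first.
  by rewrite -{2}addn1 iotaD perm_sym perm_catC /= perm_cons perm_sym pperm_perm.
by rewrite size_map /= perm_cons (iotaDl 1 1) perm_map ?pperm_perm.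
Qed.

Definition corner b v (p : pperm) : pperm := PPerm (corner_subproof b v p).

(** The new value, 1 after a shift or [n.+1], is extreme among the entries, so standardizing
    commutes with adding the corner. *)
Lemma std_corner b v n t : (forall y, y \in t -> 0 < y <= n) ->
  std (add_end b (if v then 1 else n.+1) (if v then map succn t else t)) =
  corner_seq b v (std t).
Proof.
move=> tn; rewrite std_add_end /corner_seq size_std; case: v; congr add_end.
- by rewrite count_map; congr _.+1; apply/eqP; rewrite -leqn0 leqNgt -has_count; apply/hasPn.
- rewrite -!map_comp; apply/eq_in_map => y /tn/andP[y0 _] /=.
  rewrite count_map ltnS y0 addn1; congr _.+2.
- by congr _.+1; apply/eqP; rewrite -all_count; apply/allP => y /tn/andP[_]; rewrite ltnS.
- by apply/eq_in_map => y /tn/andP[_ yn] /=; rewrite ltnNge ltnW // addn0.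
Qed.

(** The interface through which the Moebius computations treat all four corners alike.
    [le_corner_cases] distinguishes whether an occurrence uses the added point. *)
Record corner_axioms (X : pperm -> pperm) : Prop := CornerAxioms {
  corner_inj : injective X;
  size_corner : forall p, size (X p) = (size p).+1;
  le_corner : forall p, (p <= X p)%O;
  le_corner_cases : forall s p, (s <= X p)%O ->
    (s <= p)%O \/ exists2 t, (t <= p)%O & s = X t;
  le_cornerS : forall s p, (s <= p)%O -> (X s <= X p)%O }.

Lemma cornerP b v : corner_axioms (corner b v).
Proof.
have succ_mono : {mono succn : x y / x < y} by move=> x y; rewrite ltnS.
have stdS t : std (if v then map succn t else t) = std t.
  by case: v => //; apply: std_map => x y _ _; apply: succ_mono.
split.
- move=> p q /(congr1 val) /= e; apply: val_inj => /=.
  have es : size p = size q.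
    by have := congr1 size e; rewrite !size_add_end; case: (v); rewrite ?size_map; case.
  move: e; rewrite /corner_seq es /add_end.
  have Sinj : injective (map succn) by apply: inj_map; apply: succn_inj.
  by case: b => [[]|/rcons_inj[]]; case: (v) => // /Sinj.
- by move=> p; rewrite size_add_end; case: v {stdS}; rewrite ?size_map.
- move=> p; apply/le_stdP; exists (if v then map succn p else p).
    rewrite /= /corner_seq /add_end; case: b; first exact: subseq_cons.
    exact: subseq_rcons.
  by rewrite stdS std_id.
- move=> s p /le_stdP[t]; rewrite /= /corner_seq.
  have mapP' u : subseq u (if v then map succn p else p) ->
    exists2 u', subseq u' p & u = (if v then map succn u' else u').
    by case: (v) => [/subseq_mapP//|us]; exists u.
  case/subseq_add_end_cases=> [/mapP'[u up ->]|[_ /mapP'[u up ->] ->]].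
    by rewrite stdS => su; left; apply/le_stdP; exists u.
  rewrite std_corner; last by move=> y /(mem_subseq up); rewrite pperm_mem.
  (* An occurrence consisting of the added point alone is the permutation 1, which already lies
     below [p]. *)
  case: (eqVneq u [::]) => [-> e|u0 e].
    left; rewrite (_ : s = one_pperm) ?le_one //; apply: pperm_size1.
    by rewrite e size_add_end; case: v {stdS mapP' e}.
  have uu : uniq u by apply: subseq_uniq up (pperm_uniq p).
  right; exists (PPerm (std_pperm uu u0)); last exact: val_inj.
  by apply/le_stdP; exists u.
- move=> s p /le_stdP[u up e]; apply/le_stdP.
  exists (add_end b (if v then 1 else (size p).+1) (if v then map succn u else u)).
    by apply: subseq_add_end; case: (v) => //; apply: map_subseq.
  rewrite std_corner; last by move=> y /(mem_subseq up); rewrite pperm_mem.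
  by rewrite /= e.
Qed.

Lemma corner_comm b v p :
  corner b v (corner (~~ b) (~~ v) p) = corner (~~ b) (~~ v) (corner b v p).
Proof.
apply: val_inj; rewrite /= /corner_seq !size_add_end !map_add_end.
by case: b; case: v => /=; rewrite ?size_map.
Qed.

Lemma pperm_corner_seq b v s : s != [::] -> is_pperm (corner_seq b v s) -> is_pperm s.
Proof.
move=> s0 /andP[_]; rewrite /is_pperm s0 /corner_seq size_add_end perm_add_end.
case: v; last first.
  by rewrite -{2}addn1 iotaD perm_sym perm_catC /= perm_cons perm_sym.

by rewrite size_map /= perm_cons (iotaDl 1 1) => /(perm_map_inj succn_inj).
Qed.

(** Removing both opposite corner points leaves a common core [r]. If the core is empty, the length
    is two and [p] is 1. *)
Lemma corner_overlap b v p q : corner b v p = corner (~~ b) (~~ v) q ->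
  p = one_pperm \/ exists2 r, p = corner (~~ b) (~~ v) r & q = corner b v r.
Proof.
have H v' s t : s != [::] -> corner_seq true v' s = corner_seq false (~~ v') t ->
  exists2 r, s = corner_seq false (~~ v') r & t = corner_seq true v' r.
  move=> s0 e; have es : size s = size t.
    by have := congr1 size e; rewrite !size_add_end; case: (v'); rewrite ?size_map; case.
  case: v' e; rewrite /corner_seq /= ?es.
    case: t es => [|y t] es /=; first by case: s s0 es.
    case/lastP: s s0 es => // s x _ es [<-]; move: es.
    rewrite size_rcons map_rcons => -[est] /rcons_inj[<- [->]].
    by exists s; rewrite // size_map.
  case: t es => [|y t] es /=; first by move: s0; rewrite -size_eq0 es.
  by case=> e1 e2; exists t; rewrite // e1.
have K v' p' q' : corner true v' p' = corner false (~~ v') q' ->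
  p' = one_pperm \/ exists2 r, p' = corner false (~~ v') r & q' = corner true v' r.
  move=> /(congr1 val)/(H _ _ _ (pperm_neq0 p'))[r ep eq].
  case: (eqVneq r [::]) => [r0|r0].
    by left; apply: pperm_size1; rewrite ep r0; case: (v').
  have pr : is_pperm r.
    by apply: (@pperm_corner_seq true v') => //; rewrite -eq; apply: valP.
  by right; exists (PPerm pr); apply: val_inj.
case: b => e; first exact: K.
have [|q1|[r -> ->]] := K (~~ v) q p; first by rewrite negbK.
  left; apply: pperm_size1; have := congr1 size (congr1 val e).
  by rewrite q1 !size_add_end; case: (v); rewrite ?size_map; case.
by right; exists r; rewrite ?negbK.
Qed.

Lemma corner_one b v : corner b v one_pperm = corner (~~ b) (~~ v) one_pperm.
Proof. by apply: val_inj; case: b; case: v. Qed.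

(** The entry at that end would be both least and greatest in a permutation of length at least
    two. *)
Lemma corner_flip_value b v p q : corner b v p <> corner b (~~ v) q.
Proof.
have H p' q' : corner b true p' <> corner b false q'.
  move/(congr1 val) => /= e; have es : size p' = size q'.
    by have := congr1 size e; rewrite !size_add_end size_map => -[].
  have := size_pperm_gt0 p'; move: e; rewrite /corner_seq es.
  by case: b => /= [[e _]|/rcons_inj[_ e]]; lia.
by case: v => [|/esym]; apply: H.
Qed.

(** The same extreme value would have to stand at both ends. *)
Lemma corner_flip_end b v p q : corner b v p <> corner (~~ b) v q.
Proof.
have H p' q' : corner true v p' <> corner false v q'.
  move/(congr1 val) => /=; rewrite /corner_seq /add_end.
  case/lastP: (p' : seq nat) (pperm_neq0 p') (pperm_mem p') => // s x _ /(_ x).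
  rewrite mem_rcons mem_head size_rcons => /esym/andP[x0 xs].
  case: v; rewrite ?map_rcons -rcons_cons => /rcons_inj[] e; first by lia.
  by have := congr1 size e; rewrite /=; lia.
by case: b => [|/esym]; apply: H.
Qed.

Local Open Scope ring_scope.

(** * Sums of the Moebius function over order ideals *)

Local Notation M := (mobius one_pperm).

(** The length bound only makes the enumeration finite; it may be changed as long as it covers the
    support. *)
Lemma eq_sum_pperms (F : pperm -> int) n m (P Q : pred pperm) : P =1 Q ->
  (forall l, P l -> (size l <= n)%N && (size l <= m)%N) ->
  \sum_(l <- pperms_upto n | P l) F l = \sum_(l <- pperms_upto m | Q l) F l.
Proof.
move=> PQ Pn; rewrite -[LHS]big_filter -[RHS]big_filter; apply: perm_big.
apply: uniq_perm; rewrite ?filter_uniq ?uniq_pperms_upto // => l.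
rewrite !mem_filter !mem_pperms_upto -PQ.
by case: (boolP (P l)) => // /Pn/andP[-> ->].
Qed.

Lemma sum_le (F : pperm -> int) (p : pperm) :
  \sum_(l <- pperms_upto (size p) | (l <= p)%O) F l =
  F p + \sum_(l <- pperms_upto (size p) | (l < p)%O) F l.
Proof.
rewrite big_mkcond (bigD1_seq p) ?uniq_pperms_upto ?mem_pperms_upto //= lexx.
congr (_ + _); rewrite -big_mkcondr /=; apply: eq_bigl => l.
by rewrite lt_neqAle.
Qed.

(** Since 1 lies below everything, the ideal of [p] is an interval, and the recursion defining the
    Moebius function applies. *)
Lemma sum_downset n (p : pperm) : (size p <= n)%N ->
  \sum_(l <- pperms_upto n | (l <= p)%O) M l = (p == one_pperm)%:R.
Proof.
move=> pn; rewrite (@eq_sum_pperms _ n (size p) _ (fun l => (l <= p)%O)) //; last first.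
  by move=> l lp; have := contained_size lp; lia.
have -> : \sum_(l <- pperms_upto (size p) | (l <= p)%O) M l =
    M p + \sum_(l <- pinterval one_pperm p) M l.
  rewrite sum_le big_filter; congr (_ + _); apply: eq_bigl => l.
  by rewrite le_one.
case: eqVneq => [->|p1].
  rewrite mobius_refl big_seq big1 ?addr0 // => l.
  by rewrite mem_pinterval => /andP[_ /lt_geF]; rewrite le_one.
by rewrite mobius_lt ?addNr // lt_neqAle eq_sym p1 le_one.
Qed.

(** Moebius inversion in the form used below: two functions agree once their sums over all principal
    ideals agree. *)
Lemma downset_sum0 (F : pperm -> int) :
  (forall p : pperm, \sum_(l <- pperms_upto (size p) | (l <= p)%O) F l = 0) ->
  forall p, F p = 0.
Proof.
move=> F0 p; have [n] := ubnP (size p); elim: n p => // n IHn p pn.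
have := F0 p; rewrite sum_le big1 ?addr0 // => l lp; apply: IHn.
by have := lt_size lp; lia.
Qed.

(** A decidable search: preimages longer than [l] are ignored, which is correct when [X] never
    shortens. *)
Definition in_image (X : pperm -> pperm) (l : pperm) : bool :=
  has (fun p => l == X p) (pperms_upto (size l)).

Lemma in_imageP (X : pperm -> pperm) l : (forall p : pperm, (size p <= size (X p))%N) ->
  reflect (exists p, l = X p) (in_image X l).
Proof.
move=> Xs; apply: (iffP hasP) => [[p _ /eqP ->]|[p ->]]; first by exists p.
by exists p => //; rewrite mem_pperms_upto.
Qed.

Lemma sum_image (X : pperm -> pperm) n (C : pred pperm) (F : pperm -> int) : injective X ->
  (forall p : pperm, (size p <= size (X p))%N) -> (forall l, C l -> (size l <= n)%N) ->
  \sum_(l <- pperms_upto n | C l) F l =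
  \sum_(l <- pperms_upto n | C l && ~~ in_image X l) F l +
  \sum_(p <- pperms_upto n | C (X p)) F (X p).
Proof.
move=> Xi Xs Cn; rewrite (bigID (in_image X)) /= addrC; congr (_ + _).
rewrite -big_filter -[RHS]big_filter -(big_map X predT F); apply: perm_big.
apply: uniq_perm; rewrite ?(map_inj_uniq Xi) ?filter_uniq ?uniq_pperms_upto // => l.
rewrite mem_filter mem_pperms_upto.
apply/andP/mapP => [[/andP[Cl /(in_imageP _ Xs)[p lp]] _]|[p]].
  exists p => //; rewrite mem_filter mem_pperms_upto -lp Cl.
  by have := Xs p; have := Cn _ Cl; rewrite lp; lia.
rewrite mem_filter => /andP[CXp _] ->; rewrite CXp (Cn _ CXp); split=> //=.
by apply/(in_imageP _ Xs); exists p.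
Qed.

(** * Cancellation along one corner operation *)

Section Corner.
Variables (X : pperm -> pperm).
Hypothesis (ax : corner_axioms X).

Lemma leq_size_corner (p : pperm) : (size p <= size (X p))%N.
Proof. by rewrite (size_corner ax). Qed.

Lemma in_cornerP l : reflect (exists p, l = X p) (in_image X l).
Proof. exact/in_imageP/leq_size_corner. Qed.

Lemma corner_neq1 p : X p <> one_pperm.
Proof.
move/(congr1 (fun q : pperm => size q)); rewrite (size_corner ax) /=.
by have := size_pperm_gt0 p; lia.
Qed.

Lemma le_corner_drop l p : ~~ in_image X l -> (l <= X p)%O = (l <= p)%O.
Proof.
move=> nl; apply/idP/idP => [|lp]; last exact: le_trans lp (le_corner ax p).
case/(le_corner_cases ax) => // -[t _ e]; case/negP: nl.
by apply/in_cornerP; exists t.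
Qed.

Lemma le_corner2 l p : (X l <= X p)%O = (l <= p)%O.
Proof.
apply/idP/idP => [|/(le_cornerS ax)//].
case/(le_corner_cases ax) => [|[t tp /(corner_inj ax) ->] //].
exact: le_trans (le_corner ax l).
Qed.

(** The ideal of [X p] consists of the [l <= p] without an X-corner and of all [X l] with [l <= p].
    Its sum of [M] vanishes, so the ideal sums of [M (X l) + [l has no X-corner] M l] vanish and
    inversion applies. *)
Lemma mobius_corner p : M (X p) = - (if in_image X p then 0 else M p).
Proof.
apply/eqP; rewrite -addr_eq0; apply/eqP; move: p.
apply: downset_sum0 => p; rewrite big_split /= addrC.
have := @sum_downset (size (X p)) (X p) (leqnn _); have /eqP/negbTE -> := @corner_neq1 p; rewrite mulr0n.
rewrite (sum_image _ (corner_inj ax) leq_size_corner); last first.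
  by move=> l /contained_size.
move=> e0; rewrite -[RHS]e0; congr (_ + _).
  rewrite (eq_bigr (fun l => if ~~ in_image X l then M l else 0)) -?big_mkcondr.
    apply: eq_sum_pperms => l.
      by case: (boolP (in_image X l)) => [|nl]; rewrite ?andbF // le_corner_drop.
    by case/andP=> /contained_size lp _; rewrite lp (leq_trans lp) ?leq_size_corner.
  by move=> l _; case: in_image.
apply: eq_sum_pperms => l; first by rewrite le_corner2.
by move/contained_size=> lp; rewrite lp (leq_trans lp) ?leq_size_corner.
Qed.

Lemma sum_corner n (C : pred pperm) : (forall l, C l -> (size l <= n)%N) ->
  \sum_(l <- pperms_upto n | C l) M l =
  \sum_(l <- pperms_upto n | C l && ~~ in_image X l) M l -
  \sum_(p <- pperms_upto n | C (X p) && ~~ in_image X p) M p.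
Proof.
move=> Cn; rewrite (sum_image _ (corner_inj ax) leq_size_corner Cn); congr (_ + _).
rewrite -sumrN big_mkcondr /=; apply: eq_bigr => p _; rewrite mobius_corner.
by case: in_image; rewrite ?oppr0.
Qed.

End Corner.

(** * Pinwheels of corner operations *)

Record opposite_corners (L R : pperm -> pperm) : Prop := OppositeCorners {
  opp_cornerl : corner_axioms L;
  opp_cornerr : corner_axioms R;
  opp_comm : forall p, L (R p) = R (L p);
  opp_one : L one_pperm = R one_pperm;
  opp_overlap : forall p q, L p = R q ->
    p = one_pperm \/ exists2 r, p = R r & q = L r }.

Lemma opposite_cornersC L R : opposite_corners L R -> opposite_corners R L.
Proof.
case=> cL cR LRC LR1 ov; split=> // p q /esym e.
case: (ov _ _ e) => [q1|[r -> ->]]; last by right; exists r.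
by left; apply: (corner_inj cR); rewrite -LR1 -e q1.
Qed.

(** The permutation 1 is kept apart because [L one_pperm = R one_pperm], so that there [l], [L l],
    [R l] and [L (R l)] are not four distinct permutations. *)
Definition cornerless (L R : pperm -> pperm) (p : pperm) : bool :=
  [&& p != one_pperm, ~~ in_image L p & ~~ in_image R p].

Lemma cornerlessC L R : cornerless L R =1 cornerless R L.
Proof. by move=> p; rewrite /cornerless [X in _ && X]andbC. Qed.

Section Opposite.
Variables (L R : pperm -> pperm).
Hypothesis (LR : opposite_corners L R).
Let cL := opp_cornerl LR.
Let cR := opp_cornerr LR.

Lemma in_image_opposite p :
  in_image L (R p) = (p == one_pperm) || in_image L p.
Proof.
apply/(in_cornerP cL)/orP => [[q e]|[/eqP ->|/(in_cornerP cL)[q ->]]].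
- case: (opp_overlap (opposite_cornersC LR) e) => [->|[r -> _]]; first by left.
  by right; apply/(in_cornerP cL); exists r.
- by exists one_pperm; rewrite (opp_one LR).
- by exists (R q); rewrite (opp_comm LR).
Qed.

(** Cancels along [L], then along [R] in both resulting sums. Each [cornerless] permutation [l] then
    accounts for [l], [L l], [R l] and [L (R l)], with signs. *)
Lemma sum_opposite n (C : pred pperm) : (forall l, C l -> (size l <= n)%N) ->
  C one_pperm -> C (L one_pperm) ->
  \sum_(l <- pperms_upto n | C l) M l =
  \sum_(l <- pperms_upto n | C l && cornerless L R l) M l -
  \sum_(l <- pperms_upto n | C (L l) && cornerless L R l) M l -
  \sum_(l <- pperms_upto n | C (R l) && cornerless L R l) M l +
  \sum_(l <- pperms_upto n | C (L (R l)) && cornerless L R l) M l.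
Proof.
move=> Cn C1 CL1.
have im1 X : corner_axioms X -> in_image X one_pperm = false.
  by move=> cX; apply/(in_cornerP cX) => -[p /esym/(corner_neq1 cX)].
have Cn1 l : C l && ~~ in_image L l -> (size l <= n)%N by case/andP=> /Cn.
have Cn2 l : C (L l) && ~~ in_image L l -> (size l <= n)%N.
  by case/andP=> /Cn H _; apply: leq_trans (leq_size_corner cL l) H.
rewrite (sum_corner cL Cn) (sum_corner cR Cn1) (sum_corner cR Cn2).
have n1 : one_pperm \in pperms_upto n by rewrite mem_pperms_upto Cn.
(* The permutation 1 passes both filters without being [cornerless]; its value 1 enters twice, with
   opposite signs. *)
have split1 (D : pred pperm) : D one_pperm ->
    \sum_(l <- pperms_upto n | (D l && ~~ in_image L l) && ~~ in_image R l) M l =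
    1 + \sum_(l <- pperms_upto n | D l && cornerless L R l) M l.
  move=> D1; rewrite big_mkcond (bigD1_seq one_pperm) ?uniq_pperms_upto //=.
  rewrite D1 !im1 //= mobius_refl; congr (_ + _).
  rewrite -big_mkcondr /=; apply: eq_bigl => l.
  by rewrite /cornerless; case: (D l); case: (in_image L l); case: (in_image R l); case: eqP.
rewrite (split1 C) // (split1 (fun l => C (L l))) //.
(* No extra term arises here: [R one_pperm = L one_pperm] has an L-corner. *)
have dropR (D : pred pperm) :
    \sum_(l <- pperms_upto n | (D (R l) && ~~ in_image L (R l)) && ~~ in_image R l) M l =
    \sum_(l <- pperms_upto n | D (R l) && cornerless L R l) M l.
  by apply: eq_bigl => l; rewrite in_image_opposite /cornerless negb_or !andbA.
rewrite (dropR C) (dropR (fun l => C (L l))); ring.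
Qed.

End Opposite.

(** Opposite corners can coexist, adjacent ones cannot. The abstraction turns rotations into
    substitutions, so each computation is made for one orientation only. *)
Record pinwheel (L R T B : pperm -> pperm) : Prop := Pinwheel {
  pin_LR : opposite_corners L R;
  pin_TB : opposite_corners T B;
  pin_LT : forall p q, L p <> T q;
  pin_LB : forall p q, L p <> B q;
  pin_RT : forall p q, R p <> T q;
  pin_RB : forall p q, R p <> B q }.

Lemma pinwheel_half_turn L R T B : pinwheel L R T B -> pinwheel R L B T.
Proof. by case=> LR TB *; split=> //; apply: opposite_cornersC. Qed.

Lemma pinwheel_quarter_turn L R T B : pinwheel L R T B -> pinwheel T B R L.
Proof.
by case=> LR TB LT LB RT RB; split=> // [|p q /esym /RT|p q /esym /LT|p q /esym /RB|p q /esym /LB];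
  rewrite //; apply: opposite_cornersC.
Qed.

(** The ideal A of the overview. For the actual corners, its generators are the balloon of [a] with
    one outer point deleted; see [balloon_deletions]. *)
Definition pinwheel_arms (L R T B : pperm -> pperm) (a l : pperm) : bool :=
  [|| (l <= T (R (B a)))%O, (l <= R (B (L a)))%O, (l <= B (L (T a)))%O
    | (l <= L (T (R a)))%O].

Section PinwheelArms.
Variables (L R T B : pperm -> pperm).
Hypothesis (pin : pinwheel L R T B).
Let cL := opp_cornerl (pin_LR pin).
Let cR := opp_cornerr (pin_LR pin).
Let cT := opp_cornerl (pin_TB pin).
Let cB := opp_cornerr (pin_TB pin).
Let LRC := opp_comm (pin_LR pin).

Let notT_L p : ~~ in_image T (L p).
Proof. by apply/(in_cornerP cT) => -[q /(pin_LT pin)]. Qed.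
Let notB_L p : ~~ in_image B (L p).
Proof. by apply/(in_cornerP cB) => -[q /(pin_LB pin)]. Qed.
Let notT_R p : ~~ in_image T (R p).
Proof. by apply/(in_cornerP cT) => -[q /(pin_RT pin)]. Qed.
Let notB_R p : ~~ in_image B (R p).
Proof. by apply/(in_cornerP cB) => -[q /(pin_RB pin)]. Qed.

Let notR_L l : cornerless L R l -> ~~ in_image R (L l).
Proof.
case/and3P=> l1 _ lR; rewrite (in_image_opposite (opposite_cornersC (pin_LR pin))).
by rewrite (negbTE l1).
Qed.

Let notL_R l : cornerless L R l -> ~~ in_image L (R l).
Proof.
by case/and3P=> l1 lL _; rewrite (in_image_opposite (pin_LR pin)) (negbTE l1).
Qed.

Lemma le_corner_trans X l p : corner_axioms X -> (X l <= p)%O -> (l <= p)%O.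
Proof. by move=> cX; apply/le_trans/le_corner. Qed.

Lemma arms_L a l : cornerless L R l ->
  pinwheel_arms L R T B a (L l) = (l <= T (R a))%O.
Proof.
move=> nl; rewrite /pinwheel_arms.
rewrite (le_corner_drop cT) // (le_corner_drop cR) ?notR_L // (le_corner_drop cB) //.
rewrite (le_corner_drop cR) ?notR_L // (le_corner_drop cB) // (le_corner2 cL).
rewrite (le_corner_drop cB) // !(le_corner2 cL).
case: (boolP (l <= T (R a))%O) => [|nlT]; rewrite ?orbT // orbF.
have nla : (l <= a)%O = false.
  apply: contraNF nlT => la; apply: le_trans la _.
  exact: le_trans (le_corner cR a) (le_corner cT _).
rewrite nla; apply: contraNF nlT => /orP[/(le_corner_trans cL)|].
  by rewrite nla.
by move/le_trans; apply; apply/(le_cornerS cT)/le_corner.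
Qed.

(** Peeling leaves [L l <= a], [l <= a], [R l <= a] and [l <= a] for the four arms. *)
Lemma arms_LR a l : cornerless L R l ->
  pinwheel_arms L R T B a (L (R l)) = (l <= a)%O.
Proof.
move=> nl; rewrite /pinwheel_arms.
rewrite (le_corner_drop cT) // LRC (le_corner2 cR) (le_corner_drop cB) //.
rewrite (le_corner2 cR) (le_corner_drop cB) // (le_corner2 cL).
rewrite (le_corner_drop cB) // -LRC !(le_corner2 cL).
rewrite (le_corner_drop cT) // (le_corner_drop cT) // (le_corner2 cR).
case: (boolP (l <= a)%O) => [|nla]; rewrite ?orbT // !orbF.
apply: contraNF nla => /orP[/(le_corner_trans cL)//|/(le_corner_trans cR)//].
Qed.

(** Apply [sum_opposite] to the vanishing sum over the ideal of [B (L a)]. The condition on [L l]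
    reduces to [l <= a], while those on [R l] and [L (R l)] both reduce to [R l <= a] and cancel. *)
Lemma sum_cornerless_arm n a : (size (B (L a)) <= n)%N ->
  \sum_(l <- pperms_upto n | (l <= B (L a))%O && cornerless L R l) M l =
  \sum_(l <- pperms_upto n | (l <= a)%O && cornerless L R l) M l.
Proof.
move=> an; have := sum_downset an.
have /eqP/negbTE -> := @corner_neq1 _ cB (L a); rewrite mulr0n.
rewrite (sum_opposite (pin_LR pin)); first last.
- apply: le_trans (le_corner cB _); rewrite (le_corner2 cL); exact: le_one.
- exact: le_one.
- by move=> l /contained_size /leq_trans; apply.
rewrite (eq_bigl (fun l => (l <= a)%O && cornerless L R l)
  (P1 := fun l => (L l <= _)%O && _)); last first.
  by move=> l; rewrite (le_corner_drop cB) // (le_corner2 cL).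
rewrite (eq_bigl (fun l => (L (R l) <= B (L a))%O && cornerless L R l)
  (P1 := fun l => (R l <= _)%O && _)); last first.
  move=> l; case: (boolP (cornerless L R l)) => nl; rewrite ?andbF ?andbT //.
  rewrite (le_corner_drop cB) // (le_corner_drop cL) ?notL_R //.
  by rewrite (le_corner_drop cB) // (le_corner2 cL).
by move/eqP; rewrite subrK subr_eq0 => /eqP.
Qed.

Lemma arms_none a l : ~~ in_image T l -> ~~ in_image B l ->
  cornerless L R l -> pinwheel_arms L R T B a l = (l <= a)%O.
Proof.
move=> lT lB /and3P[_ lL lR]; rewrite /pinwheel_arms.
rewrite !(le_corner_drop cT, le_corner_drop cB, le_corner_drop cL, le_corner_drop cR) //.
by rewrite !orbb.
Qed.

End PinwheelArms.

Lemma pinwheel_armsC L R T B a l :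
  pinwheel_arms R L B T a l = pinwheel_arms L R T B a l.
Proof.
rewrite /pinwheel_arms; case: (l <= T (R (B a)))%O; case: (l <= R (B (L a)))%O;
  case: (l <= B (L (T a)))%O; by case: (l <= L (T (R a)))%O.
Qed.

Lemma pinwheel_arms_quarter L R T B a l :
  pinwheel_arms T B R L a l = pinwheel_arms L R T B a l.
Proof.
rewrite /pinwheel_arms; case: (l <= T (R (B a)))%O; case: (l <= R (B (L a)))%O;
  case: (l <= B (L (T a)))%O; by case: (l <= L (T (R a)))%O.
Qed.

Lemma arms_size L R T B (a l : pperm) : pinwheel L R T B ->
  pinwheel_arms L R T B a l -> (size l <= size a + 3)%N.
Proof.
case=> [[cL cR _ _ _] [cT cB _ _ _] _ _ _ _] /or4P[] /contained_size;
  rewrite !(size_corner cL, size_corner cR, size_corner cT, size_corner cB); lia.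
Qed.

Lemma arms_le L R T B a l : pinwheel L R T B ->
  (l <= a)%O -> pinwheel_arms L R T B a l.
Proof.
case=> [[_ cR _ _ _] [cT cB _ _ _] _ _ _ _] la; apply/or4P/Or41.
by do 3!(apply: le_trans; last exact/le_corner); exact: la.
Qed.

(** In [sum_opposite] the terms for [L l], [R l] and [L (R l)] run over [l <= T (R a)],
    [l <= B (L a)] and [l <= a]. All three sums are equal and carry the signs -, -, +. *)
Lemma sum_arms_half L R T B (a : pperm) n : pinwheel L R T B -> (size a + 3 <= n)%N ->
  \sum_(l <- pperms_upto n | pinwheel_arms L R T B a l) M l =
  \sum_(l <- pperms_upto n | pinwheel_arms L R T B a l && cornerless L R l) M l -
  \sum_(l <- pperms_upto n | (l <= a)%O && cornerless L R l) M l.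
Proof.
move=> pin an; have pin' := pinwheel_half_turn pin.
have [LRo TBo _ _ _ _] := pin.
have [cL cR LRC _ _] := LRo; have [cT cB _ _ _] := TBo.
rewrite (sum_opposite LRo); first last.
- rewrite (_ : pinwheel_arms _ _ _ _ _ _) //; apply/or4P/Or44.
  by rewrite (le_corner2 cL) le_one.
- by apply: arms_le => //; apply: le_one.
- by move=> l /(arms_size pin) /leq_trans; apply.
have -> : \sum_(l <- pperms_upto n | pinwheel_arms L R T B a (L l) && cornerless L R l) M l
    = \sum_(l <- pperms_upto n | (l <= a)%O && cornerless L R l) M l.
  under eq_bigl => l do rewrite cornerlessC.
  rewrite -[RHS](eq_bigl _ _ (fun l => congr1 (andb (l <= a)%O) (cornerlessC R L l))).
  (* The half turn yields the version for [T (R a)]. *)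
  rewrite -(sum_cornerless_arm pin'); last first.
    by rewrite (size_corner cT) (size_corner cR); lia.
  apply: eq_bigl => l; case: (boolP (cornerless R L l)) => nl; rewrite ?andbF ?andbT //.
  by rewrite (arms_L pin) // cornerlessC.
have -> : \sum_(l <- pperms_upto n | pinwheel_arms L R T B a (R l) && cornerless L R l) M l
    = \sum_(l <- pperms_upto n | (l <= a)%O && cornerless L R l) M l.
  rewrite -(sum_cornerless_arm pin); last first.
    by rewrite (size_corner cB) (size_corner cL); lia.
  apply: eq_bigl => l; case: (boolP (cornerless L R l)) => nl; rewrite ?andbF ?andbT //.
  by rewrite -pinwheel_armsC (arms_L pin') // cornerlessC.
have -> : \sum_(l <- pperms_upto n | pinwheel_arms L R T B a (L (R l)) && cornerless L R l) M l
    = \sum_(l <- pperms_upto n | (l <= a)%O && cornerless L R l) M l.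
  apply: eq_bigl => l; case: (boolP (cornerless L R l)) => nl; rewrite ?andbF ?andbT //.
  by rewrite (arms_LR pin).
ring.
Qed.

(* No permutation has corners on both diagonals: this is inclusion-exclusion.
   The summand 1 is the contribution of [one_pperm], which is not [cornerless]
   by convention. *)
Lemma sum_by_diagonals L R T B n (C : pred pperm) : pinwheel L R T B ->
  (0 < n)%N -> C one_pperm ->
  \sum_(l <- pperms_upto n | C l) M l =
  1 + \sum_(l <- pperms_upto n | C l && cornerless L R l) M l
  + \sum_(l <- pperms_upto n | C l && cornerless T B l) M l
  - \sum_(l <- pperms_upto n | C l && (cornerless L R l && cornerless T B l)) M l.
Proof.
move=> pin n0 C1.
have [[cL cR _ _ _] [cT cB _ _ _] LT LB RT RB] := pin.
(* Writing 1 as a sum supported at [one_pperm] lets the identity be checked term by term. *)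
have -> : 1 = \sum_(l <- pperms_upto n) (if l == one_pperm then M l else 0).
  rewrite (bigD1_seq one_pperm) ?uniq_pperms_upto ?mem_pperms_upto //= ?eqxx.
  by rewrite mobius_refl big1 ?addr0 // => l /negbTE ->.
rewrite !(big_mkcond (fun l => C l)) !(big_mkcond (fun l => C l && _)).
rewrite -sumrN -!big_split; apply: eq_bigr => l _ /=.
case: eqP => [->|/eqP l1]; first by rewrite C1 /cornerless ?eqxx /= mobius_refl; ring.
case: (C l) => /=; last by ring.
rewrite /cornerless l1 /=.
case: (in_cornerP cL l) => [[p e]|_]; case: (in_cornerP cR l) => [[q e']|_];
case: (in_cornerP cT l) => [[u f]|_]; case: (in_cornerP cB l) => [[v f']|_] /=;
  try (by case: (LT p u); rewrite -e -f); try (by case: (LB p v); rewrite -e -f');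
  try (by case: (RT q u); rewrite -e' -f); try (by case: (RB q v); rewrite -e' -f');
  by ring.
Qed.

(** Let S be this sum. Inclusion-exclusion over the diagonals is applied to the arms and to the
    ideal of [a]. By [sum_arms_half] each diagonal sum over the arms is S plus that over the ideal,
    and the sums without any corner agree. Hence S = 2 S + [a = 1]. *)
Lemma sum_arms L R T B (a : pperm) n : pinwheel L R T B -> (size a + 3 <= n)%N ->
  \sum_(l <- pperms_upto n | pinwheel_arms L R T B a l) M l = - (a == one_pperm)%:R.
Proof.
move=> pin an; have pin' := pinwheel_quarter_turn pin.
have aon : pinwheel_arms L R T B a one_pperm by apply/(arms_le pin)/le_one.
have n0 : (0 < n)%N by lia.
have an' : (size a <= n)%N by lia.
rewrite -(sum_downset an') (sum_by_diagonals pin n0 (le_one a)).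
have := sum_by_diagonals pin n0 aon.
have hLR := sum_arms_half pin an.
have hTB := sum_arms_half pin' an.
rewrite (eq_bigl _ _ (pinwheel_arms_quarter L R T B a)) in hTB.
have eTB l : pinwheel_arms T B R L a l && cornerless T B l =
    pinwheel_arms L R T B a l && cornerless T B l.
  by rewrite pinwheel_arms_quarter.
rewrite (eq_bigl _ _ eTB) in hTB.
have e0 l : pinwheel_arms L R T B a l && (cornerless L R l && cornerless T B l) =
    (l <= a)%O && (cornerless L R l && cornerless T B l).
  case: (boolP (cornerless L R l)) => nLR; rewrite ?andbF //=.
  case: (boolP (cornerless T B l)) => [/and3P[_ lT lB]|_]; rewrite ?andbF //=.
  by rewrite (arms_none pin).
rewrite (eq_bigl _ _ e0) => e; move: hLR hTB e.
do 6!(move: (bigop _ _ _) => ?).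
lia.
Qed.

Local Close Scope ring_scope.

(** * Permutations below a balloon *)

Local Notation cornerLL := (corner true true).
Local Notation cornerUR := (corner false false).
Local Notation cornerUL := (corner true false).
Local Notation cornerLR := (corner false true).

Lemma corner_opposite b v : opposite_corners (corner b v) (corner (~~ b) (~~ v)).
Proof.
split; [exact: cornerP|exact: cornerP|exact: corner_comm|exact: corner_one|].
exact: corner_overlap.
Qed.

Lemma corner_pinwheel : pinwheel cornerLL cornerUR cornerUL cornerLR.
Proof.
split; [exact: (corner_opposite true true)|exact: (corner_opposite true false)|..];
  move=> p q.
- exact: (@corner_flip_value true true).
- exact: (@corner_flip_end true true).
- exact: (@corner_flip_end false false).
- exact: (@corner_flip_value false false).
Qed.

Lemma std_balloon n (u : seq nat) : (forall y, y \in u -> 0 < y <= n) ->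
  std ([:: 2; n + 4] ++ [seq x + 2 | x <- u] ++ [:: 1; n + 3]) =
  balloon2413_seq (std u).
Proof.
move=> un; rewrite /balloon2413_seq size_std {1}/std.
set s := _ ++ _.
have cE k : count (fun y => y < k) s =
    (2 < k) + (n + 4 < k) + count (fun y => y + 2 < k) u + (1 < k) + (n + 3 < k).
  have e : count (preim (addn^~ 2) (fun y => y < k)) u = count (fun y => y + 2 < k) u.
    exact: eq_count.
  by rewrite /s !count_cat count_map e /=; lia.
have all_u (P : pred nat) : (forall y, y \in u -> P y) -> count P u = size u.
  by move=> Pu; apply/eqP; rewrite -all_count; apply/allP.
have none_u (P : pred nat) : (forall y, y \in u -> ~~ P y) -> count P u = 0.
  by move=> Pu; apply/eqP; rewrite -leqn0 leqNgt -has_count; apply/hasPn.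
have mE (f : nat -> nat) : map f s =
    [:: f 2, f (n + 4) & [seq f (x + 2) | x <- u] ++ [:: f 1; f (n + 3)]].
  by rewrite /s !map_cat -map_comp.
clearbody s; rewrite mE !cE.
rewrite !(none_u (fun y => y + 2 < 2)) ?(none_u (fun y => y + 2 < 1)); try by move=> y; lia.
rewrite !(all_u (fun y => y + 2 < n + 4)) ?(all_u (fun y => y + 2 < n + 3));
  try by move=> y /un; lia.
congr [:: _, _ & _ ++ [:: _; _]]; try lia.
rewrite -map_comp; apply/eq_in_map => x /un xn /=; rewrite cE.
rewrite (eq_count (a2 := fun y => y < x)); last by move=> y /=; lia.
lia.
Qed.

Lemma arms_seq (a : pperm) : let k := size a in
  [/\ (cornerUL (cornerUR (cornerLR a)) : seq nat) =
        k + 3 :: [seq x + 1 | x <- a] ++ [:: 1; k + 2],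
      (cornerUR (cornerLR (cornerLL a)) : seq nat) =
        2 :: [seq x + 2 | x <- a] ++ [:: 1; k + 3],
      (cornerLR (cornerLL (cornerUL a)) : seq nat) =
        [:: 2, k + 3 & [seq x + 2 | x <- a] ++ [:: 1]] &
      (cornerLL (cornerUL (cornerUR a)) : seq nat) =
        [:: 1, k + 3 & [seq x + 1 | x <- a] ++ [:: k + 2]]].
Proof.
have S2 : [seq (succn \o succn) i | i <- a] = [seq x + 2 | x <- a] by apply: eq_map => x; rewrite addn2.
have S1 : [seq i.+1 | i <- a] = [seq x + 1 | x <- a] by apply: eq_map => x; rewrite addn1.
split; rewrite /= /corner_seq /= ?map_rcons ?size_rcons ?size_map /= -?map_comp
  ?size_rcons ?size_map -?cats1 -?catA /=  ?(addn1, addn2, addn3) ?S1 ?S2 //.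
Qed.

(** An increasing relabelling of values, which avoids standardizing fragments of a balloon
    explicitly. *)
Definition order_isomorphic (p : pperm) (s : seq nat) : Prop :=
  exists2 g, {mono g : x y / x < y} & s = map g p.

Lemma le_isomorphic (l p : pperm) s t : order_isomorphic p s -> subseq t s ->
  l = std t :> seq nat -> (l <= p)%O.
Proof.
case=> g gm -> /subseq_mapP[u up ->]; rewrite std_map => [lu|x y _ _]; last exact: gm.
by apply/le_stdP; exists u.
Qed.

Lemma isomorphic_le (p q : pperm) s : order_isomorphic p s -> subseq s q ->
  (p <= q)%O.
Proof.
case=> g gm -> sq; apply/le_stdP; exists (map g p) => //.
by rewrite std_map ?std_id // => x y _ _; apply: gm.
Qed.

(** The deleted values are 2, [k + 4], [k + 3] and 1 in turn; each relabelling raises exactly the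
    values from the deleted one upwards. *)
Lemma balloon_deletions (a : pperm) :
  let k := size a in let m := [seq x + 2 | x <- a] in
  [/\ order_isomorphic (cornerUL (cornerUR (cornerLR a))) (k + 4 :: m ++ [:: 1; k + 3]),
      order_isomorphic (cornerUR (cornerLR (cornerLL a))) (2 :: m ++ [:: 1; k + 3]),
      order_isomorphic (cornerLR (cornerLL (cornerUL a))) [:: 2, k + 4 & m ++ [:: 1]] &
      order_isomorphic (cornerLL (cornerUL (cornerUR a))) [:: 2, k + 4 & m ++ [:: k + 3]]].
Proof.
have [e1 e2 e3 e4] := arms_seq a; move=> k m; split.
- exists (fun x => x + (1 < x)); first by move=> x y; lia.
  rewrite e1 /= map_cat /= -map_comp; congr [:: _ & _ ++ [:: _; _]]; try lia.
  by apply/eq_in_map => x; rewrite pperm_mem /=; lia.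
- by exists id; rewrite ?e2 ?map_id.
- exists (fun x => x + (k + 3 <= x)); first by move=> x y; lia.
  rewrite e3 /= map_cat /= -map_comp; congr [:: _, _ & _ ++ [:: _]]; try lia.
  by apply/eq_in_map => x; rewrite pperm_mem /=; lia.
- exists (fun x => x + 1); first by move=> x y; lia.
  rewrite e4 /= map_cat /= -map_comp; congr [:: _, _ & _ ++ [:: _]]; try lia.
  by apply/eq_map => x /=; lia.
Qed.

Local Notation arms := (pinwheel_arms cornerLL cornerUR cornerUL cornerLR).

Lemma arms_le_balloon a l : arms a l -> (l <= balloon2413 a)%O.
Proof.
have [i1 i2 i3 i4] := balloon_deletions a.
have cons2 (x y : nat) s t : subseq s t -> subseq (x :: s) (x :: y :: t).
  by move=> st; rewrite /= eqxx; apply: subseq_trans st (subseq_cons _ _).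
case/or4P=> /le_trans; apply; rewrite /balloon2413_seq.
- by apply: isomorphic_le i1 _; apply: subseq_cons.
- by apply: isomorphic_le i2 _; apply: cons2.
- apply: isomorphic_le i3 _; rewrite /= /balloon2413_seq /= ?eqxx.
  by rewrite cat_subseq //= eqxx.
- apply: isomorphic_le i4 _; rewrite /= /balloon2413_seq /= ?eqxx.
  by rewrite cat_subseq //; apply: subseq_cons.
Qed.

Definition pperm2413 : pperm := @PPerm [:: 2; 4; 1; 3] isT.

(** Test the outer points 2, [k + 4], [k + 3], 1 in turn: the first one missed by the occurrence
    puts [l] below the corresponding arm. If all are used, what remains is a pattern [u] of [a], and
    an empty [u] gives 2413. *)
Lemma le_balloon_cases a l : (l <= balloon2413 a)%O ->
  [\/ arms a l, l = pperm2413 | exists2 d, (d <= a)%O & l = balloon2413 d].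
Proof.
have [i1 i2 i3 i4] := balloon_deletions a.
set k := size a in i1 i2 i3 i4; set m := [seq x + 2 | x <- a] in i1 i2 i3 i4.
have sE : balloon2413_seq a = add_end true 2 (add_end true (k + 4)
    (add_end false (k + 3) (add_end false 1 m))) by rewrite /= -!cats1 -catA.
case/le_stdP => t; rewrite -[X in subseq _ X]/(balloon2413_seq a) sE.
case/subseq_add_end_cases=> [t1 lt|[t1 + ->]].
  by constructor 1; apply/or4P/Or41/(le_isomorphic i1 _ lt); move: t1; rewrite /add_end -!cats1 -catA.
case/subseq_add_end_cases=> [t2 lt|[t2 + ->]].
  constructor 1; apply/or4P/Or42/(le_isomorphic i2 _ lt).
  by move: t2; rewrite /add_end -!cats1 -catA /= ?eqxx.
case/subseq_add_end_cases=> [t3 lt|[t3 + ->]].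
  constructor 1; apply/or4P/Or43/(le_isomorphic i3 _ lt).
  by move: t3; rewrite /= -!cats1 ?eqxx.
case/subseq_add_end_cases=> [t4 lt|[t4 + ->]].
  constructor 1; apply/or4P/Or44/(le_isomorphic i4 _ lt).
  by move: t4; rewrite /= ?eqxx -!cats1 => t4; apply: cat_subseq.
case/subseq_mapP=> u ua ->.
rewrite (_ : add_end _ _ _ = [:: 2; k + 4] ++ [seq x + 2 | x <- u] ++ [:: 1; k + 3]);
  last by rewrite /= -!cats1 -catA.
rewrite std_balloon; last by move=> y /(mem_subseq ua); rewrite pperm_mem.
case: (eqVneq u [::]) => [-> e|u0 e]; first by constructor 2; apply: val_inj.
constructor 3; exists (PPerm (std_pperm (subseq_uniq ua (pperm_uniq a)) u0)).
  by apply/le_stdP; exists u.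
exact: val_inj.
Qed.

(** * Monotonicity and injectivity of the balloon, and its lack of corners *)

Lemma subseq_balloon (u a : seq nat) n : subseq u a ->
  subseq ([:: 2; n + 4] ++ [seq x + 2 | x <- u] ++ [:: 1; n + 3])
    ([:: 2; n + 4] ++ [seq x + 2 | x <- a] ++ [:: 1; n + 3]).
Proof. by move=> ua; rewrite !cat_subseq ?map_subseq. Qed.

Lemma le_balloonS (d a : pperm) : (d <= a)%O -> (balloon2413 d <= balloon2413 a)%O.
Proof.
case/le_stdP=> u ua e; apply/le_stdP.
exists ([:: 2; size a + 4] ++ [seq x + 2 | x <- u] ++ [:: 1; size a + 3]).
  exact: subseq_balloon.
rewrite std_balloon; last by move=> y /(mem_subseq ua); rewrite pperm_mem.
by rewrite /= e.
Qed.

Lemma le_2413_balloon (a : pperm) : (pperm2413 <= balloon2413 a)%O.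
Proof.
apply/le_stdP; exists ([:: 2; size a + 4] ++ [seq x + 2 | x <- [::]] ++ [:: 1; size a + 3]).
  by apply: subseq_balloon; apply: sub0seq.
by rewrite std_balloon.
Qed.

Lemma le_balloon (a : pperm) : (a <= balloon2413 a)%O.
Proof. exact/arms_le_balloon/(arms_le corner_pinwheel). Qed.

Lemma size_balloon (a : pperm) : size (balloon2413 a) = size a + 4.
Proof. by rewrite /= /balloon2413_seq !size_cat size_map /=; lia. Qed.

Lemma balloon_inj : injective balloon2413.
Proof.
move=> a b e; apply: val_inj; have es : size a = size b.
  by have := congr1 (fun p : pperm => size p) e; rewrite !size_balloon; lia.
have := congr1 val e; rewrite /= /balloon2413_seq /= es => -[] /eqP.
rewrite eqseq_cat ?size_map // => /andP[/eqP + _].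
by apply: inj_map => x y; lia.
Qed.

(** Neither the first entry 2 nor the last entry is extreme. Taking a sequence [s] includes the
    empty one, whose balloon is 2413. *)
Lemma balloon_not_corner b v (s : seq nat) (p : pperm) :
  balloon2413_seq s <> corner b v p.
Proof.
rewrite /= /corner_seq /balloon2413_seq => e.
have es : size s + 4 = (size p).+1.
  have := congr1 size e; rewrite size_add_end !size_cat size_map /=.
  by case: (v); rewrite ?size_map; lia.
move: e; case: b => /= [[]|]; first by case: v; lia.
move: (map _ s) => m; rewrite -[_ ++ _]/(_ ++ ([:: 1] ++ [:: _])).
by rewrite !catA cats1 -!rcons_cons => /rcons_inj[_]; case: v; lia.
Qed.

Lemma arms_balloon a s (p : pperm) : p = balloon2413_seq s :> seq nat ->
  arms a p = (p <= a)%O.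
Proof.
move=> ps; have no b v : ~~ in_image (corner b v) p.
  apply/(in_cornerP (cornerP b v)) => -[q e].
  by apply: (@balloon_not_corner b v s q); rewrite -ps e.
rewrite (arms_none corner_pinwheel) // /cornerless !no !andbT.
by apply: contra_eq_neq ps => ->; case: s.
Qed.

Local Open Scope ring_scope.

(** * The Moebius function of a balloon *)

Lemma sum_eq_pperm (F : pperm -> int) n (P : pred pperm) (q : pperm) :
  (size q <= n)%N ->
  \sum_(l <- pperms_upto n | P l && (l == q)) F l = if P q then F q else 0.
Proof.
move=> qn; rewrite big_mkcond (bigD1_seq q) ?uniq_pperms_upto ?mem_pperms_upto //=.
by rewrite eqxx andbT big1 ?addr0 // => l /negbTE ->; rewrite andbF.
Qed.

Local Notation "'im_balloon'" := (in_image balloon2413).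

Lemma leq_size_balloon (p : pperm) : (size p <= size (balloon2413 p))%N.
Proof. by rewrite size_balloon leq_addr. Qed.

Lemma im_balloonP l : reflect (exists p, l = balloon2413 p) (im_balloon l).
Proof. exact/in_imageP/leq_size_balloon. Qed.

Lemma pperm2413_not_balloon : ~~ im_balloon pperm2413.
Proof.
apply/im_balloonP => -[p /(congr1 (fun q : pperm => size q))].
by rewrite size_balloon /=; have := size_pperm_gt0 p; lia.
Qed.

Local Arguments mobius : simpl never.

(** Both sides have the same sum over every principal ideal. The correction at 2413 has ideal sum
    [[2413 <= p] M 2413], the one at 1 the constant [M 2413]. *)
Lemma mobius_balloon (p : pperm) :
  M (balloon2413 p) = M p + (if im_balloon p then M p else 0)
    + (if p == pperm2413 then M p else 0)
    - (if p == one_pperm then M pperm2413 else 0).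
Proof.
apply/eqP; rewrite -subr_eq0; apply/eqP; move: p; apply: downset_sum0 => p.
set n := (size (balloon2413 p)).
have pn : (size p <= n)%N := leq_size_balloon p.
have pn3 : (size p + 3 <= n)%N by rewrite /n size_balloon leq_add2l.
have q_n : (size pperm2413 <= n)%N by rewrite /n size_balloon /=; lia.
rewrite (@eq_sum_pperms _ _ n _ (fun l => (l <= p)%O)) //; last first.
  by move=> l /contained_size lp; rewrite lp (leq_trans lp pn).
have n1 : (size one_pperm <= n)%N by apply: leq_trans pn; apply: size_pperm_gt0.
have mk (Q : pred pperm) (F : pperm -> int) :
    \sum_(l <- pperms_upto n | (l <= p)%O) (if Q l then F l else 0) =
    \sum_(l <- pperms_upto n | (l <= p)%O && Q l) F l by rewrite big_mkcondr.
rewrite !sumrB !big_split /= (mk im_balloon) (mk (fun l => l == pperm2413)).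
rewrite (mk (fun l => l == one_pperm) (fun=> M pperm2413)).
rewrite (@sum_eq_pperm (fun=> M pperm2413)) // le_one.
rewrite sum_eq_pperm // sum_downset //.
have Cn l : (l <= balloon2413 p)%O && ~~ arms p l -> (size l <= n)%N.
  by case/andP=> /contained_size.
have := @sum_downset n (balloon2413 p) (leqnn n).
(* The ideal of the balloon splits into the arms, the non-balloons outside them and the balloons
   outside them. *)
rewrite (bigID (arms p)) /= (sum_image _ balloon_inj leq_size_balloon Cn).
rewrite (eq_bigl (arms p)); last first.
  by move=> l; case: (boolP (arms p l)) => [/arms_le_balloon -> //|]; rewrite andbF.
rewrite (sum_arms corner_pinwheel) //.
(* The only possible non-balloon outside the arms is 2413, which is there exactly when it is not
   below [p]. *)
rewrite (eq_bigl (fun l => ~~ (pperm2413 <= p)%O && (l == pperm2413))); last first.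
  move=> l; case: eqP => [->|lq]; rewrite ?andbF ?andbT /=.
    rewrite le_2413_balloon pperm2413_not_balloon andbT.
    by rewrite (@arms_balloon p [::]).
  apply/negP=> /andP[/andP[/le_balloon_cases[->//|//|[d _ ->]] _] /im_balloonP[]].
  by exists d.
rewrite (sum_eq_pperm _ (fun=> ~~ (pperm2413 <= p)%O)) //.
(* Balloons have no corners, so lying in the arms means lying below [p]. *)
rewrite (eq_bigl (fun l => (l <= p)%O && ~~ (balloon2413 l <= p)%O)); last first.
  move=> d; rewrite (@arms_balloon p d) //.
  case: (boolP (balloon2413 d <= p)%O) => nd; rewrite ?andbF ?andbT //.
  apply/idP/idP => [|/le_balloonS//].
  case/le_balloon_cases => [|dq|[e ep /balloon_inj -> //]].
    by rewrite (@arms_balloon p d) // (negbTE nd).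
  by case/negP: pperm2413_not_balloon; rewrite -dq; apply/im_balloonP; exists d.
rewrite [\sum_(l <- _ | (l <= p)%O) M (balloon2413 l)](bigID (fun l => balloon2413 l <= p)%O) /=.
(* Reindexes the balloons below [p] by their inner permutations; adding the non-balloons to both
   sides makes [sum_image] applicable. *)
have eI : \sum_(l <- pperms_upto n | (l <= p)%O && im_balloon l) M l =
    \sum_(l <- pperms_upto n | (balloon2413 l <= p)%O) M (balloon2413 l).
  have sp l : (l <= p)%O -> (size l <= n)%N by move/contained_size/leq_trans->.
  apply/(addrI (\sum_(l <- pperms_upto n | (l <= p)%O && ~~ im_balloon l) M l)).
  by rewrite -(sum_image _ balloon_inj leq_size_balloon sp) [RHS](bigID im_balloon) addrC.
have eA : \sum_(l <- pperms_upto n | (l <= p)%O && (balloon2413 l <= p)%O) M (balloon2413 l) =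
    \sum_(l <- pperms_upto n | (balloon2413 l <= p)%O) M (balloon2413 l).
  apply: eq_bigl => d; apply/andP/idP => [[]//|le]; split=> //.
  exact: le_trans (le_balloon d) le.
rewrite eI eA; move: (_%:R) => u.
by case: (pperm2413 <= p)%O => /= e; rewrite -[RHS]e; ring.
Qed.

Theorem theorem12 (beta pi : pperm) (hbeta : is_balloon2413 beta)
  (hpi : pi = balloon2413 beta) :
  mobius one_pperm pi = 2 * mobius one_pperm beta.
Proof.
case: hbeta hpi => g -> ->; rewrite mobius_balloon.
have -> : im_balloon (balloon2413 g) by apply/im_balloonP; exists g.
(* Both corrections vanish: 2413 is not the balloon of a non-empty permutation, and a balloon is
   longer than 1. *)
case: eqP => [e|_].
  by case/negP: pperm2413_not_balloon; rewrite -e; apply/im_balloonP; exists g.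
have -> : (balloon2413 g == one_pperm) = false.
  by apply/eqP => /(congr1 (fun q : pperm => size q)); rewrite size_balloon addnC.
ring.
Qed.
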